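(* Let $\mathbf{M}=(I,M_1,\ldots,M_k)$, $M_i\in\mathbb{R}^{n\times n}$, have the row $\mathcal{W}$-property. Then the following hold. (i) For any two block vectors $\mathbf{q}=(0,q_1,\ldots,q_k)$ and $\tilde{\mathbf{q}}=(0,\tilde q_1,\ldots,\tilde q_k)$ with $q_i,\tilde q_i\in\mathbb{R}^n$, $$\|x^*-y^*\|\le\sum_{i=1}^k\tilde\alpha_i(\mathbf{M})\,\|\tilde q_i-q_i\|,$$ where $x^*$ and $y^*$ are the unique solutions of VLCP $(\mathbf{M},\mathbf{q})$ and VLCP $(\mathbf{M},\tilde{\mathbf{q}})$, respectively. (ii) Let $0\le\eta<1$. Every block matrix $\tilde{\mathbf{A}}=(I,A_1,\ldots,A_k)\in\tilde{\mathfrak{M}}:=\{\tilde{\mathbf{A}}=(I,A_1,\ldots,A_k):\sum_{i=1}^k\tilde\alpha_i(\mathbf{M})\|A_i-M_i\|\le\eta<1\}$ has the row $\mathcal{W}$-property. Let $\tilde\tau_i(\mathbf{M})=\frac{1}{1-\eta}\tilde\alpha_i(\mathbf{M})$. Then for any $\tilde{\mathbf{A}}=(I,A_1,\ldots,A_k)$ and $\tilde{\mathbf{B}}=(I,B_1,\ldots,B_k)$ in $\tilde{\mathfrak{M}}$, and any $\hat{\mathbf{q}}=(0,\hat q_1,\ldots,\hat q_k)$ and $\hat{\mathbf{p}}=(0,\hat p_1,\ldots,\hat p_k)$ with $\hat q_i,\hat p_i\in\mathbb{R}^n$, $$\|x^*-y^*\|\le\Big(\sum_{i=1}^k\tilde\tau_i(\mathbf{M})\|A_i-B_i\|\Big)\Big(\sum_{i=1}^k\tilde\tau_i(\mathbf{M})\|(-\hat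 p_i)_+\|\Big)+\sum_{i=1}^k\tilde\tau_i(\mathbf{M})\|\hat q_i-\hat p_i\|,$$ where $x^*$ and $y^*$ are the unique solutions of VLCP $(\tilde{\mathbf{A}},\hat{\mathbf{q}})$ and VLCP $(\tilde{\mathbf{B}},\hat{\mathbf{p}})$, respectively.
   Context: VLCP $(\mathbf{M},\mathbf{q})$, for $\mathbf{M}=(I,M_1,\ldots,M_k)$ with $M_i\in\mathbb{R}^{n\times n}$ and $\mathbf{q}=(0,q_1,\ldots,q_k)$ with $q_i\in\mathbb{R}^n$, is the problem of finding $x\in\mathbb{R}^n$ with $\min\{x,M_1x+q_1,\ldots,M_kx+q_k\}=0$, where $\min$ is the componentwise minimum. A block matrix $(M_0,\ldots,M_k)$ has the row $\mathcal{W}$-property if $\min(M_0x,\ldots,M_kx)\le 0\le \max(M_0x,\ldots,M_kx)$ (componentwise min, max and inequalities) implies $x=0$. Under the row $\mathcal{W}$-property the VLCP has a unique solution. $\mathcal{D}$ is the set of all tuples $(D_0,\ldots,D_k)$ of $n\times n$ diagonal matrices with diagonal entries in $[0,1]$ and $\sum_{i=0}^kD_i=I$. For $(D_0,\ldots,D_k)\in\mathcal{D}$ put $S^v_{\mathbf{M}}=D_0+\sum_{i=1}^kD_iM_i$ (nonsingular when $\mathbf{M}$ has the row $\mathcal{W}$-property), and $\tilde\alpha_i(\mathbf{M})=\max_{(D_0,\ldots,D_k)\in\mathcal{D}}\|(S^v_{\mathbf{M}})^{-1}D_i\|$ for $i=1,\ldots,k$. For a vector $q$, $q_+=\max\{0,q\}$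 componentwise. $\|\cdot\|$ denotes a fixed vector $p$-norm with $p\ge 1$ ($p=\infty$ allowed) and, for matrices, its induced operator norm. *)

(* Defs.v *)
From mathcomp Require Import all_boot all_order all_algebra.
From mathcomp Require Import boolp classical_sets reals constructive_ereal exp.
Set Implicit Arguments.
Unset Strict Implicit.
Unset Printing Implicit Defensive.
Import Order.TTheory GRing.Theory Num.Theory.
Local Open Scope classical_set_scope.
Local Open Scope ring_scope.

(* The block [(a, f_1, ..., f_k)]; the index [i : 'I_k] of [f] stands for
   position [i + 1], i.e. for [lift ord0 i : 'I_k.+1]. *)
Definition block_cons (T : Type) (k : nat) (a : T) (f : 'I_k -> T)
    (i : 'I_k.+1) : T :=
  oapp f a (unlift ord0 i).

Section VLCP.
Variables (R : realType) (n k : nat).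
Implicit Types (x y q : 'cV[R]_n).

Definition lev x y : Prop := forall j, x j 0 <= y j 0.

(* The seed [v ord0] is itself one of the [v i], so it does not affect the
   extrema. *)
Definition block_min (v : 'I_k.+1 -> 'cV[R]_n) : 'cV[R]_n :=
  \col_j \big[Num.min/v ord0 j 0]_(i < k.+1) v i j 0.

Definition block_max (v : 'I_k.+1 -> 'cV[R]_n) : 'cV[R]_n :=
  \col_j \big[Num.max/v ord0 j 0]_(i < k.+1) v i j 0.

Definition row_W (M : 'I_k.+1 -> 'M[R]_n) : Prop :=
  forall x, lev (block_min (fun i => M i *m x)) 0 ->
            lev 0 (block_max (fun i => M i *m x)) -> x = 0.

Definition VLCP_sol (M : 'I_k.+1 -> 'M[R]_n) (q : 'I_k.+1 -> 'cV[R]_n) x :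
    Prop :=
  block_min (fun i => M i *m x + q i) = 0.

Definition diag_partition : set ('I_k.+1 -> 'M[R]_n) :=
  [set D | (forall i, is_diag_mx (D i) /\ forall j, 0 <= D i j j <= 1) /\
           \sum_(i < k.+1) D i = 1%:M].

Definition Sv (M : 'I_k -> 'M[R]_n) (D : 'I_k.+1 -> 'M[R]_n) : 'M[R]_n :=
  D ord0 + \sum_(i < k) D (lift ord0 i) *m M i.

Definition pos_part q : 'cV[R]_n := \col_j Num.max 0 (q j 0).

(* The value at [-oo] is irrelevant: [p] is always assumed to be at least 1. *)
Definition vnorm (p : \bar R) x : R :=
  match p with
  | r%:E => (\sum_j `|x j 0| `^ r) `^ r^-1
  | +oo%E => \big[Num.max/0]_j `|x j 0|
  | -oo%E => 0
  end.

Definition opnorm (p : \bar R) (A : 'M[R]_n) : R :=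
  sup [set vnorm p (A *m x) | x in [set x | vnorm p x <= 1]].

(* The maximum over the compact set [diag_partition] is rendered by [sup]. *)
Definition alpha (p : \bar R) (M : 'I_k -> 'M[R]_n) (i : 'I_k) : R :=
  sup [set opnorm p (invmx (Sv M D) *m D (lift ord0 i)) | D in diag_partition].

Definition tau (p : \bar R) (eta : R) (M : 'I_k -> 'M[R]_n) (i : 'I_k) : R :=
  (1 - eta)^-1 * alpha p M i.

Definition perturb_set (p : \bar R) (eta : R) (M : 'I_k -> 'M[R]_n) :
    set ('I_k -> 'M[R]_n) :=
  [set A | \sum_(i < k) alpha p M i * opnorm p (A i - M i) <= eta].

End VLCP.

(* Main.v *)
Require Import Defs.
From mathcomp Require Import all_boot all_order all_algebra.
From mathcomp Require Import boolp classical_sets reals constructive_ereal exp.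
From mathcomp Require Import unstable interval_inference convex hoelder perm.
From mathcomp Require Import ring lra.
Import Order.TTheory GRing.Theory Num.Theory.
Local Open Scope classical_set_scope.
Local Open Scope ring_scope.

(** Write [A_0 = I] and [q_0 = 0] for the leading blocks. If [x] solves the
    problem [(A, q)] and [y] solves [(B, r)], then in every row [j] the
    numbers [(A_i x + q_i)_j] are nonnegative and one of them vanishes, and
    likewise for [(B_i y + r_i)_j]. Their differences therefore take a
    nonpositive and a nonnegative value, so some convex combination of them is
    zero. Collecting the weights of all rows in diagonal matrices [D_i] turns
    the two nonlinear problems into one linear equation for the difference of
    the solutions ([VLCP_sol_diff]):
    [S_A (x - y) = \sum_(i >= 1) D_i ((B_i - A_i) y + (r_i - q_i))].
    The same choice of weights shows that a vector violating the row
    W-property of [A] is in the kernel of some [S_A].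

    Everything else is an estimate for such an equation.  For [A = M], applying
    the inverse of [S_M] to [S_M z = \sum_i D_i w_i] gives
    [|z| <= \sum_i alpha_i |w_i|] ([vnorm_Sv_le]).  For [A] in the perturbation
    set, [S_A = S_M + \sum_i D_i (A_i - M_i)]; moving the perturbation to the
    right-hand side costs at most [eta |z|], so the same estimate holds with
    [tau_i = alpha_i / (1 - eta)] ([perturb_vnorm_Sv_le]).  The first claim, the
    row W-property of [A] and the last bound all follow; in the last one [|y|]
    is estimated by comparing [y] with [0], which solves the problem whose
    right-hand sides are the positive parts of the [r_i].

    The real numbers [alpha_i] are suprema, hence meaningful only if the norms
    [|S_M^-1 D_i|] are bounded ([alpha_has_ubound]).  Instead of compactness and
    continuity the proof uses that the rows of [S_M] are convex combinations of
    the corresponding rows of [I, M_1, ..., M_k].  By multilinearity [det S_M]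
    is then a convex combination of finitely many determinants, those of the
    matrices that pick each row from one block.  Each of these is positive: along
    the segment from [I] to such a matrix the determinant is a polynomial which
    is [1] at the start and has no zero, by the row W-property.  So [det S_M] has
    a positive lower bound, and Cramer's rule bounds the inverse. *)

(** * The p-norm *)

(** Minkowski's inequality for finite sums.  After normalization,
    [(u + v) / (a + b)] is a convex combination of [u / a] and [v / b] with
    weight [a / (a + b)], so the convexity of the [r]-th power applies termwise
    and the bound [t * 1 + (1 - t) * 1 = 1] results. *)
Lemma ler_sum_powRD {R : realType} {I : finType} (r a b : R) (u v : I -> R) :
  1 <= r -> 0 < a -> 0 < b ->
  \sum_i `|u i| `^ r = a `^ r -> \sum_i `|v i| `^ r = b `^ r ->
  \sum_i `|u i + v i| `^ r <= (a + b) `^ r.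
Proof.
move=> r1 a0 b0 ua vb; have r0 : 0 <= r by rewrite (le_trans _ r1).
have ab0 : 0 < a + b by rewrite addr_gt0.
pose t := a / (a + b).
have t0 : 0 <= t by rewrite divr_ge0 ?ltW.
have t1 : t <= 1 by rewrite ler_pdivrMr// mul1r lerDl ltW.
have normalized (w : I -> R) c : 0 < c -> \sum_i `|w i| `^ r = c `^ r ->
    \sum_i (`|w i| / c) `^ r = 1.
  move=> c0 wc; have cr : c `^ r != 0 by rewrite gt_eqF// powR_gt0.
  apply: (mulIf cr); rewrite mul1r mulr_suml -[RHS]wc.
  apply: eq_bigr => i _.
  by rewrite -powRM ?divr_ge0 ?(ltW c0)// divfK// gt_eqF.
have -> : (a + b) `^ r =
  (a + b) `^ r * (t * (\sum_i (`|u i| / a) `^ r) +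
                  (1 - t) * (\sum_i (`|v i| / b) `^ r)).
  by rewrite !normalized// !mulr1 subrKC mulr1.
rewrite 2![_ * \sum_i _]mulr_sumr -big_split/= mulr_sumr.
apply: ler_sum => i _.
have ua0 : 0 <= `|u i| / a by rewrite divr_ge0 ?(ltW a0).
have vb0 : 0 <= `|v i| / b by rewrite divr_ge0 ?(ltW b0).
have uv0 : 0 <= t * (`|u i| / a) + (1 - t) * (`|v i| / b).
  by rewrite addr_ge0// mulr_ge0// subr_ge0.
have := convex_powR r1 (Itv01 t0 t1)
  (mem_set (_ : `[0, +oo[%classic (`|u i| / a)))
  (mem_set (_ : `[0, +oo[%classic (`|v i| / b))).
rewrite /= !in_itv/= ua0 vb0 => /(_ isT isT).
rewrite convRE [X in X `^ _ <= _]convRE /= /onem => cvx.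
apply: le_trans (ler_wpM2l (powR_ge0 _ _) cvx).
rewrite -powRM ?(ltW ab0)//.
apply: ge0_ler_powR; rewrite ?nnegrE// ?mulr_ge0 ?(ltW ab0)//.
apply: le_trans (ler_normD _ _) _; rewrite le_eqVlt; apply/orP; left.
by apply/eqP; rewrite /t; field; rewrite !gt_eqF.
Qed.

Section PNorm.
Context {R : realType} {n : nat} {p : \bar R} (hp : (1 <= p)%E).
Implicit Types (x y : 'cV[R]_n) (c : R).

Lemma vnorm_ge0 x : 0 <= vnorm p x.
Proof.
by case: p => [r| |] /=; rewrite ?powR_ge0//; exact: bigmax_ge_id.
Qed.

Lemma vnorm_powR (r : R) x : 0 < r ->
  vnorm r%:E x `^ r = \sum_j `|x j 0| `^ r.
Proof.
move=> r0 /=; rewrite -powRrM mulVf ?gt_eqF// powRr1//.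
by apply: sumr_ge0 => j _; exact: powR_ge0.
Qed.

Lemma vnormZ c x : vnorm p (c *: x) = `|c| * vnorm p x.
Proof.
case: p hp => [r| |] //=; rewrite ?lee_fin => r1.
  have r0 : 0 < r by rewrite (lt_le_trans _ r1).
  under eq_bigr do rewrite mxE normrM powRM//.
  rewrite -mulr_sumr powRM ?powR_ge0//; last first.
    by apply: sumr_ge0 => j _; exact: powR_ge0.
  by rewrite -powRrM mulfV ?gt_eqF// powRr1.
have -> : \big[Num.max/0]_j `|(c *: x) j 0| =
          \big[Num.max/0]_j (`|c| * `|x j 0|).
  by apply: eq_bigr => j _; rewrite mxE normrM.
elim/big_rec2: _ => [|j a b _ ->]; first by rewrite mulr0.
by rewrite maxr_pMr.
Qed.

Lemma vnorm0 : vnorm p (0 : 'cV[R]_n) = 0.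
Proof. by rewrite -(scale0r 0) vnormZ normr0 mul0r. Qed.

Lemma vnormN x : vnorm p (- x) = vnorm p x.
Proof. by rewrite -scaleN1r vnormZ normrN1 mul1r. Qed.

Lemma ler_coord_vnorm x j : `|x j 0| <= vnorm p x.
Proof.
case: p hp => [r| |] //=; rewrite ?lee_fin => r1; last exact: le_bigmax.
have r0 : 0 < r by rewrite (lt_le_trans _ r1).
rewrite -[leLHS]powRr1// -(mulfV (lt0r_neq0 r0)) powRrM.
apply: ge0_ler_powR; rewrite ?invr_ge0 ?(ltW r0) ?nnegrE ?powR_ge0//.
  by apply: sumr_ge0 => i _; exact: powR_ge0.
by rewrite (bigD1 j)//= lerDl; apply: sumr_ge0 => i _; exact: powR_ge0.
Qed.

Lemma vnorm0_eq0 x : vnorm p x = 0 -> x = 0.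
Proof.
move=> x0; apply/matrixP => j l; rewrite ord1 mxE; apply/eqP.
by rewrite -normr_le0 -x0 ler_coord_vnorm.
Qed.

Lemma ler_vnormD x y : vnorm p (x + y) <= vnorm p x + vnorm p y.
Proof.
have [/vnorm0_eq0 ->|a0] := eqVneq (vnorm p x) 0.
  by rewrite add0r lerDr vnorm_ge0.
have [/vnorm0_eq0 ->|b0] := eqVneq (vnorm p y) 0.
  by rewrite addr0 lerDl vnorm_ge0.
have {a0}: 0 < vnorm p x by rewrite lt0r a0 vnorm_ge0.
have {b0}: 0 < vnorm p y by rewrite lt0r b0 vnorm_ge0.
case: p hp ler_coord_vnorm => [r| |] //; rewrite ?lee_fin => r1 lex.
  have r0 : 0 < r by rewrite (lt_le_trans _ r1).
  move=> b0 a0; have ab0 := addr_gt0 a0 b0.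
  rewrite -[leRHS]powRr1 ?(ltW ab0)// -(mulfV (lt0r_neq0 r0)) powRrM.
  apply: ge0_ler_powR; rewrite ?invr_ge0 ?(ltW r0) ?nnegrE ?powR_ge0//.
    by apply: sumr_ge0 => i _; exact: powR_ge0.
  under eq_bigr do rewrite mxE.
  by apply: ler_sum_powRD => //; rewrite vnorm_powR.
move=> b0 a0; apply: bigmax_le; first by rewrite addr_ge0 ?ltW.
move=> j _; rewrite mxE (le_trans (ler_normD _ _))// lerD// lex.
Qed.

Lemma ler_vnorm_sum {I : finType} (f : I -> 'cV[R]_n) :
  vnorm p (\sum_i f i) <= \sum_i vnorm p (f i).
Proof.
elim/big_rec2: _ => [|i y s _ ih]; first by rewrite vnorm0.
by rewrite (le_trans (ler_vnormD _ _))// lerD2l.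
Qed.

Lemma vnorm_delta j : vnorm p (delta_mx j 0 : 'cV[R]_n) = 1.
Proof.
case: p hp => [r| |] //=; rewrite ?lee_fin => r1.
  have r0 : r != 0 by rewrite gt_eqF// (lt_le_trans _ r1).
  rewrite (bigD1 j)//= mxE !eqxx normr1 powR1 big1 ?addr0 ?powR1// => i ij.
  by rewrite mxE (negbTE ij) normr0 powR0.
apply: le_anti; apply/andP; split.
  apply: bigmax_le => // i _; rewrite mxE.
  by case: (_ && _); rewrite ?normr1 ?normr0.
by rewrite (bigmax_sup j)// mxE !eqxx normr1.
Qed.

(** The unit vectors have norm [1], so the triangle inequality compares any
    [p]-norm with the [1]-norm; this is what bounds operator norms by entries. *)
Lemma ler_vnorm_l1 x : vnorm p x <= \sum_j `|x j 0|.
Proof.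
have -> : x = \sum_j x j 0 *: delta_mx j 0.
  apply/matrixP => i l; rewrite ord1 summxE (bigD1 i)//= !mxE !eqxx mulr1.
  by rewrite big1 ?addr0// => j ji; rewrite !mxE eq_sym (negbTE ji) mulr0.
apply: le_trans (ler_vnorm_sum _) _; apply: ler_sum => j _.
rewrite vnormZ vnorm_delta mulr1 summxE (bigD1 j)//= !mxE !eqxx mulr1.
by rewrite big1 ?addr0// => i ij; rewrite !mxE eq_sym (negbTE ij) mulr0.
Qed.

End PNorm.

(** * The operator norm *)

Section OpNorm.
Context {R : realType} {n : nat} {p : \bar R} (hp : (1 <= p)%E).
Implicit Types (A : 'M[R]_n) (x : 'cV[R]_n).

Lemma ler_vnorm_mulmx_l1 A x :
  vnorm p (A *m x) <= (\sum_j \sum_l `|A j l|) * vnorm p x.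
Proof.
apply: le_trans (ler_vnorm_l1 hp _) _; rewrite mulr_suml.
apply: ler_sum => j _; rewrite mxE (le_trans (ler_norm_sum _ _ _))// mulr_suml.
by apply: ler_sum => l _; rewrite normrM ler_wpM2l// ler_coord_vnorm.
Qed.

(** A supremum of reals is an upper bound only for bounded sets; this makes
    [opnorm] an actual operator norm. *)
Lemma opnorm_ubound A :
  has_ubound [set vnorm p (A *m x) | x in [set x | vnorm p x <= 1]].
Proof.
exists (\sum_j \sum_l `|A j l|) => _ [x /= x1 <-].
rewrite (le_trans (ler_vnorm_mulmx_l1 _ _))// ler_piMr//.
by apply: sumr_ge0 => j _; exact: sumr_ge0.
Qed.

Lemma ler_vnorm_mulmx A x : vnorm p (A *m x) <= opnorm p A * vnorm p x.
Proof.
have [/(vnorm0_eq0 hp) ->|x0] := eqVneq (vnorm p x) 0.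
  by rewrite mulmx0 !vnorm0// mulr0.
have {}x0 : 0 < vnorm p x by rewrite lt0r x0 vnorm_ge0.
rewrite -ler_pdivrMr// /opnorm; apply: ub_le_sup; first exact: opnorm_ubound.
exists ((vnorm p x)^-1 *: x) => /=.
  by rewrite vnormZ// ger0_norm ?invr_ge0 ?(ltW x0)// mulVf// gt_eqF.
by rewrite -scalemxAr vnormZ// ger0_norm ?invr_ge0 ?(ltW x0)// mulrC.
Qed.

Lemma opnorm_ge0 A : 0 <= opnorm p A.
Proof.
apply: ub_le_sup; first exact: opnorm_ubound.
by exists 0; rewrite /= ?mulmx0 vnorm0.
Qed.

Lemma opnorm_le A c : 0 <= c ->
  (forall x, vnorm p (A *m x) <= c * vnorm p x) -> opnorm p A <= c.
Proof.
move=> c0 Ac; apply: ge_sup.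
  by exists (vnorm p (A *m 0)), 0; rewrite //= vnorm0.
by move=> _ [x /= x1 <-]; rewrite (le_trans (Ac x))// ler_piMr.
Qed.

End OpNorm.

(** * Block extrema and diagonal partitions of the identity *)

Section Blocks.
Context {R : realType} {n k : nat}.
Implicit Types (v : 'I_k.+1 -> 'cV[R]_n) (D : 'I_k.+1 -> 'M[R]_n).
Implicit Types (M : 'I_k -> 'M[R]_n).

Lemma block_cons0 T (a : T) (f : 'I_k -> T) : block_cons a f ord0 = a.
Proof. by rewrite /block_cons unlift_none. Qed.

Lemma block_consS T (a : T) (f : 'I_k -> T) i :
  block_cons a f (lift ord0 i) = f i.
Proof. by rewrite /block_cons liftK. Qed.

Lemma block_min_le0P v :
  lev (block_min v) 0 <-> forall j, exists i, v i j 0 <= 0.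
Proof.
split=> h j; move: (h j); rewrite !mxE.
  by move=> /bigmin_leP[?|[i _ ?]]; [exists ord0|exists i].
by move=> [i vi]; apply/bigmin_leP; right; exists i.
Qed.

Lemma block_max_ge0P v :
  lev 0 (block_max v) <-> forall j, exists i, 0 <= v i j 0.
Proof.
split=> h j; move: (h j); rewrite !mxE.
  by move=> /bigmax_geP[?|[i _ ?]]; [exists ord0|exists i].
by move=> [i vi]; apply/bigmax_geP; right; exists i.
Qed.

Lemma block_min_eq0P v : block_min v = 0 <->
  (forall i j, 0 <= v i j 0) /\ (forall j, exists i, v i j 0 <= 0).
Proof.
split=> [v0|[v_ge0 v_le0]].
  split=> [i j|]; last by apply/block_min_le0P => j; rewrite v0.
  have /matrixP/(_ j 0) := v0; rewrite !mxE => <-; exact: bigmin_le.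
apply/matrixP => j l; rewrite ord1 !mxE; apply: le_anti; apply/andP; split.
  by have [i vi] := v_le0 j; apply/bigmin_leP; right; exists i.
by apply/bigmin_geP; split=> [|i _]; exact: v_ge0.
Qed.

(** Only the two given indices carry weight: [t] and [1 - t] solve
    [t a_0 + (1 - t) a_1 = 0]. *)
Lemma convex_comb_eq0 {I : finType} (a : I -> R) i0 i1 :
  a i0 <= 0 -> 0 <= a i1 ->
  exists d : I -> R, [/\ forall i, 0 <= d i, \sum_i d i = 1 &
                         \sum_i d i * a i = 0].
Proof.
move=> a0 a1; pose t := a i1 / (a i1 - a i0).
have sum_dirac (f : I -> R) i2 : \sum_i (i == i2)%:R * f i = f i2.
  rewrite (bigD1 i2)//= eqxx mul1r big1 ?addr0// => i /negbTE ->.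
  by rewrite mul0r.
exists (fun i => t * (i == i0)%:R + (1 - t) * (i == i1)%:R).
have t0 : 0 <= t by rewrite divr_ge0// subr_ge0 (le_trans a0 a1).
have t1 : t <= 1.
  (* When [a i0 = a i1 = 0] the division by zero makes [t = 0]. *)
  have [e|ne] := eqVneq (a i1 - a i0) 0; first by rewrite /t e invr0 mulr0.
  rewrite ler_pdivrMr; first by rewrite mul1r; lra.
  by rewrite lt0r ne subr_ge0 (le_trans a0 a1).
have comb (f : I -> R) :
    \sum_i (t * (i == i0)%:R + (1 - t) * (i == i1)%:R) * f i =
    t * f i0 + (1 - t) * f i1.
  under eq_bigr do rewrite mulrDl -(mulrA t) -(mulrA (1 - t)).
  by rewrite big_split/= -!mulr_sumr !sum_dirac.
split=> [i||].
- by rewrite addr_ge0// mulr_ge0// subr_ge0.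
- have := comb (fun=> 1); rewrite !mulr1 subrKC => comb1.
  by rewrite -[RHS]comb1; apply: eq_bigr => i _; rewrite mulr1.
- rewrite comb /t; have [e|ne] := eqVneq (a i1 - a i0) 0; last by field.
  by rewrite e invr0 mulr0; lra.
Qed.

Lemma diag_partition_weights (d : 'I_n -> 'I_k.+1 -> R) :
  (forall j i, 0 <= d j i) -> (forall j, \sum_i d j i = 1) ->
  diag_partition (fun i => diag_mx (\row_j d j i)).
Proof.
move=> d0 d1; split=> [i|].
  split=> [|j]; first exact: diag_mx_is_diag.
  rewrite !mxE eqxx mulr1n d0 -(d1 j) (bigD1 i)//= lerDl.
  by apply: sumr_ge0.
apply/matrixP => j l; rewrite summxE !mxE.
under eq_bigr do rewrite !mxE.
by rewrite sumrMnl d1.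
Qed.

Lemma diag_partition_sum D j : diag_partition D -> \sum_i D i j j = 1.
Proof. by move=> [_ /matrixP/(_ j j)]; rewrite summxE mxE eqxx. Qed.

Lemma diag_partition_mulmx {m} D i (A : 'M[R]_(n, m)) j l :
  diag_partition D -> (D i *m A) j l = D i j j * A j l.
Proof.
move=> [/(_ i)[/is_diag_mxP Di _] _]; rewrite mxE (bigD1 j)//= big1 ?addr0//.
by move=> h hj; rewrite Di ?mul0r// eq_sym.
Qed.

(** The link between extrema and linear algebra: the existential of the row
    W-property and of the complementarity condition, one pair of indices per row,
    becomes a single linear equation. *)
Lemma diag_partition_comb_eq0 v :
  (forall j, exists i, v i j 0 <= 0) -> (forall j, exists i, 0 <= v i j 0) ->
  exists2 D, diag_partition D & \sum_i D i *m v i = 0.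
Proof.
move=> v_le0 v_ge0.
have /choice[d dP] j : exists d : 'I_k.+1 -> R, [/\ forall i, 0 <= d i,
    \sum_i d i = 1 & \sum_i d i * v i j 0 = 0].
  have [i0 vi0] := v_le0 j; have [i1 vi1] := v_ge0 j.
  exact: (convex_comb_eq0 (fun i => v i j 0) i0 i1).
have dD : diag_partition (fun i => diag_mx (\row_j d j i)).
  by apply: diag_partition_weights => [j i|j]; have [d0 d1 _] := dP j.
exists (fun i => diag_mx (\row_j d j i)) => //.
apply/matrixP => j l; rewrite ord1 summxE [RHS]mxE.
have [_ _ dv0] := dP j; rewrite -[RHS]dv0; apply: eq_bigr => i _.
by rewrite (diag_partition_mulmx _ i (v i) j 0 dD) !mxE eqxx mulr1n.
Qed.

Lemma Sv_block M D : Sv M D = \sum_i D i *m block_cons 1%:M M i.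
Proof.
rewrite /Sv big_ord_recl block_cons0 mulmx1; congr (_ + _).
by apply: eq_bigr => i _; rewrite block_consS.
Qed.

Lemma Sv_coef M D j l : diag_partition D ->
  Sv M D j l = \sum_i D i j j * block_cons 1%:M M i j l.
Proof.
move=> DD; rewrite Sv_block summxE.
by apply: eq_bigr => i _; rewrite diag_partition_mulmx.
Qed.

Lemma convex_comb_gt0 {I : finType} (d a : I -> R) :
  (forall i, 0 <= d i) -> \sum_i d i = 1 -> (forall i, 0 < a i) ->
  0 < \sum_i d i * a i.
Proof.
move=> d0 d1 a0; have da i : 0 <= d i * a i by rewrite mulr_ge0// ltW.
rewrite lt0r sumr_ge0// andbT; apply: contraTneq isT => /eqP.
rewrite psumr_eq0// => /allP da0; have : \sum_i d i = 0.
  apply: big1 => i _; apply/eqP; have := da0 i (mem_index_enum i).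
  by rewrite mulf_eq0 (gt_eqF (a0 i)) orbF.
by rewrite d1 => /eqP; rewrite oner_eq0.
Qed.

(** Row [j] of [Sv M D *m x] is a convex combination of the numbers
    [(M_i x)_j]; if it vanishes, these cannot all be positive or all negative. *)
Lemma Sv_mulmx_eq0 M D (x : 'cV[R]_n) :
  row_W (block_cons 1%:M M) -> diag_partition D ->
  Sv M D *m x = 0 -> x = 0.
Proof.
move=> hM DD; rewrite Sv_block mulmx_suml => Sx0.
have Dx j : \sum_i D i j j * (block_cons 1%:M M i *m x) j 0 = 0.
  have /matrixP/(_ j 0) := Sx0; rewrite summxE mxE => Sxj.
  rewrite -[RHS]Sxj; apply: eq_bigr => i _.
  by rewrite -mulmxA (diag_partition_mulmx _ _ _ _ _ DD).
have D0 i j : 0 <= D i j j by case: DD => /(_ i)[_ /(_ j) /andP[]].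
apply: hM; [apply/block_min_le0P => j | apply/block_max_ge0P => j];
  apply: contrapT => /forallNP h.
- suff : 0 < (0 : R) by rewrite ltxx.
  rewrite -{2}(Dx j); apply: convex_comb_gt0 => [i||i] //.
    exact: diag_partition_sum.
  by rewrite ltNge; apply/negP.
- suff : 0 < - (0 : R) by rewrite oppr0 ltxx.
  rewrite -{2}(Dx j) -sumrN.
  under eq_bigr do rewrite -mulrN.
  apply: convex_comb_gt0 => [i||i] //; first exact: diag_partition_sum.
  by rewrite oppr_gt0 ltNge; apply/negP.
Qed.

End Blocks.

(** * A uniform lower bound for determinants *)

Section Determinants.
Context {R : realType} {n k : nat}.
Implicit Types (D : 'I_k.+1 -> 'M[R]_n) (M : 'I_k -> 'M[R]_n).

(** Multilinearity of the determinant in all rows at once: distribute the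
    product over rows in each Leibniz term. *)
Lemma det_row_comb {I : finType} (d : 'I_n -> I -> R) (N : I -> 'M[R]_n) :
  \det (\matrix_(j, l) \sum_i d j i * N i j l) =
  \sum_(s : {ffun 'I_n -> I})
     (\prod_j d j (s j)) * \det (\matrix_(j, l) N (s j) j l).
Proof.
rewrite /determinant.
under [RHS]eq_bigr do rewrite mulr_sumr.
rewrite exchange_big/=; apply: eq_bigr => t _.
under eq_bigr do rewrite mxE.
rewrite bigA_distr_bigA mulr_sumr; apply: eq_bigr => s _.
rewrite big_split/= mulrCA; congr (_ * (_ * _)).
by apply: eq_bigr => j _; rewrite mxE.
Qed.

Lemma ler_norm_det m (A : 'M[R]_m) (b : R) :
  (forall j l, `|A j l| <= b) -> `|\det A| <= m`!%:R * b ^+ m.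
Proof.
move=> Ab; apply: le_trans (ler_norm_sum _ _ _) _.
apply: (@le_trans _ _ (\sum_(s : 'S_m) b ^+ m)); last first.
  by rewrite sumr_const card_Sn mulr_natl.
apply: ler_sum => s _; rewrite normrM normr_sign mul1r normr_prod.
rewrite -[in leRHS](card_ord m) -prodr_const.
by apply: ler_prod => j _; rewrite normr_ge0 Ab.
Qed.

(** Cramer's rule: the inverse is the adjugate over the determinant, and the
    entries of the adjugate are minors of size [n - 1]. *)
Lemma ler_norm_invmx (A : 'M[R]_n) (b c : R) : 0 < c -> c <= \det A ->
  (forall j l, `|A j l| <= b) ->
  forall j l, `|invmx A j l| <= c^-1 * (n.-1`!%:R * b ^+ n.-1).
Proof.
move=> c0 cA Ab j l; have A0 : 0 < \det A by rewrite (lt_le_trans c0).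
rewrite /invmx unitmxE unitfE gt_eqF//= !mxE normrM; apply: ler_pM => //.
  by rewrite ger0_norm ?invr_ge0 ?(ltW A0)// lef_pV2.
rewrite /cofactor normrM normrX normrN1 expr1n mul1r.
by apply: ler_norm_det => j' l'; rewrite !mxE.
Qed.

Lemma det_Sv_neq0 M D : row_W (block_cons 1%:M M) -> diag_partition D ->
  \det (Sv M D) != 0.
Proof.
move=> hM DD; rewrite -det_tr; apply/negP => /det0P[x /eqP x0 xS].
apply: x0; apply: trmx_inj; rewrite trmx0.
apply: (Sv_mulmx_eq0 M D) => //.
by rewrite -[Sv M D]trmxK -trmx_mul xS trmx0.
Qed.

(** Convexity of [diag_partition], for segments that start at the partition
    [(I, 0, ..., 0)], whose [Sv] is the identity matrix. *)
Lemma diag_partition_path D (t : R) : diag_partition D -> 0 <= t <= 1 ->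
  diag_partition (fun i => (1 - t) *: block_cons 1%:M (fun=> 0) i + t *: D i).
Proof.
move=> [DD D1] /andP[t0 t1]; split=> [i|]; last first.
  rewrite big_split/= -!scaler_sumr D1 big_ord_recl block_cons0 big1 => [|i _].
    by rewrite addr0 -scalerDl subrK scale1r.
  by rewrite block_consS.
have [/is_diag_mxP Di Di01] := DD i.
have /andP[e0 e1] : 0 <= (block_cons 1 (fun=> 0) i : R) <= 1.
  case: (unliftP ord0 i) => [i'|] ->.
    by rewrite block_consS lexx ler01.
  by rewrite block_cons0 lexx ler01.
have -> : block_cons 1%:M (fun=> 0) i =
          (block_cons 1 (fun=> 0) i)%:M :> 'M[R]_n.
  case: (unliftP ord0 i) => [i'|] ->; rewrite ?block_consS ?block_cons0//.
  by rewrite -scalemx1 scale0r.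
split=> [|j].
  apply/is_diag_mxP => j l jl; rewrite !mxE Di// (_ : (j == l) = false).
    by rewrite mulr0n !mulr0 addr0.
  exact: negbTE.
have /andP[d0 d1] := Di01 j; rewrite !mxE eqxx mulr1n.
by apply/andP; split; nra.
Qed.

(** The determinant is a polynomial in [t] along the segment from [I] to
    [Sv M D].  It is [1] at [t = 0], and a nonpositive value at [t = 1] would
    force a root in between, contradicting nonsingularity. *)
Lemma det_Sv_gt0 M D : row_W (block_cons 1%:M M) -> diag_partition D ->
  0 < \det (Sv M D).
Proof.
move=> hM DD.
pose P : 'M[{poly R}]_n :=
  \matrix_(j, l) ((1%:M j l)%:P + ((Sv M D - 1%:M) j l)%:P * 'X).
have PE t : (\det P).[t] = \det ((1 - t) *: 1%:M + t *: Sv M D).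
  rewrite -horner_evalE -det_map_mx; congr (\det _).
  by apply/matrixP => j l; rewrite !mxE /= /horner_eval !hornerE; ring.
rewrite ltNge; apply/negP => S0.
have : (- \det P).[0] <= 0 <= (- \det P).[1].
  rewrite !hornerN !PE subrr subr0 !scale0r !scale1r addr0 add0r det1.
  by rewrite oppr_le0 ler01 oppr_ge0.
move=> /(poly_ivt ler01)[t t01]; rewrite rootN => /rootP.
rewrite PE; apply/eqP.
have -> : (1 - t) *: 1%:M + t *: Sv M D =
  Sv M (fun i => (1 - t) *: block_cons 1%:M (fun=> 0) i + t *: D i).
  rewrite /Sv block_cons0 scalerDr addrA; congr (_ + _).
  rewrite scaler_sumr; apply: eq_bigr => i _.
  by rewrite block_consS scaler0 add0r scalemxAl.
by apply: det_Sv_neq0 => //; exact: diag_partition_path.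
Qed.

(** The determinant of [Sv M D] is a convex combination of the determinants at
    the finitely many vertices of [diag_partition], which do not depend on [D]. *)
Lemma det_Sv_lower_bound M : row_W (block_cons 1%:M M) ->
  exists2 c, 0 < c & forall D, diag_partition D -> c <= \det (Sv M D).
Proof.
move=> hM.
(* The vertices of [diag_partition]: row [j] is taken from block [s j]. *)
pose V (s : {ffun 'I_n -> 'I_k.+1}) : 'M[R]_n :=
  \matrix_(j, l) block_cons 1%:M M (s j) j l.
have V0 s : 0 < \det (V s).
  pose d j i : R := (i == s j)%:R.
  have dD : diag_partition (fun i => diag_mx (\row_j d j i)).
    apply: diag_partition_weights => [j i|j]; first by rewrite /d ler0n.
    by rewrite /d (bigD1 (s j))//= eqxx big1 ?addr0// => i /negbTE ->.
  suff -> : V s = Sv M (fun i => diag_mx (\row_j d j i)) by exact: det_Sv_gt0.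
  apply/matrixP => j l; rewrite Sv_coef// mxE (bigD1 (s j))//= big1 => [|i si].
    by rewrite !mxE /d !eqxx mul1r addr0.
  by rewrite !mxE /d (negbTE si) mul0rn mul0r.
exists (\big[Num.min/1]_s \det (V s)).
  by apply/bigmin_gtP; split=> // s _; exact: V0.
move=> D DD; set c := \big[_/_]_s _.
have -> : Sv M D = \matrix_(j, l) \sum_i D i j j * block_cons 1%:M M i j l.
  by apply/matrixP => j l; rewrite Sv_coef// mxE.
have D0 i j : 0 <= D i j j by case: DD => /(_ i)[_ /(_ j) /andP[]].
rewrite (det_row_comb (fun j i => D i j j)).
have -> : c = \sum_(s : {ffun 'I_n -> 'I_k.+1}) (\prod_j D (s j) j j) * c.
  rewrite -mulr_suml -(bigA_distr_bigA (fun j i => D i j j)) /=.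
  by rewrite big1 ?mul1r// => j _; exact: diag_partition_sum.
apply: ler_sum => s _; apply: ler_wpM2l; first exact: prodr_ge0.
exact: bigmin_le.
Qed.

End Determinants.

(** * Estimates for the matrices Sv *)

Section Perturbation.
Context {R : realType} {n k : nat} {p : \bar R} (hp : (1 <= p)%E).
Context {M : 'I_k -> 'M[R]_n} (hM : row_W (block_cons 1%:M M)).
Implicit Types (A B : 'I_k -> 'M[R]_n) (D : 'I_k.+1 -> 'M[R]_n).
Implicit Types (x y z : 'cV[R]_n) (q r w : 'I_k -> 'cV[R]_n).

(** The reason why the supremum [alpha] bounds each of its terms: both the
    entries of [Sv M D] and the inverse of its determinant are bounded
    uniformly in [D]. *)
Lemma alpha_has_ubound i : has_ubound
  [set opnorm p (invmx (Sv M D) *m D (lift ord0 i)) | D in @diag_partition R n k].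
Proof.
have [c c0 cS] := det_Sv_lower_bound M hM.
(* Crude bounds: [b] for all entries of [Sv M D], [e] for those of
   [(Sv M D)^-1 D_i]. *)
pose b : R := \sum_h \sum_j \sum_l `|block_cons 1%:M M h j l|.
pose e := c^-1 * (n.-1`!%:R * b ^+ n.-1).
exists (\sum_(j < n) \sum_(l < n) e) => _ [D DD <-].
have D01 h j : 0 <= D h j j <= 1 by case: DD => /(_ h)[_ /(_ j)].
have Sb j l : `|Sv M D j l| <= b.
  rewrite Sv_coef// (le_trans (ler_norm_sum _ _ _))//; apply: ler_sum => h _.
  have /andP[d0 d1] := D01 h j; rewrite normrM ger0_norm//.
  apply: (@le_trans _ _ `|block_cons 1%:M M h j l|); first by rewrite ler_piMl.
  rewrite (bigD1 j)//= (bigD1 l)//= -addrA lerDl addr_ge0//.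
    exact: sumr_ge0.
  by apply: sumr_ge0 => j' _; exact: sumr_ge0.
have invb := ler_norm_invmx _ _ _ c0 (cS D DD) Sb.
have SDe j l : `|(invmx (Sv M D) *m D (lift ord0 i)) j l| <= e.
  have [/(_ (lift ord0 i))[/is_diag_mxP Di _] _] := DD.
  rewrite mxE (bigD1 l)//= big1 => [|h hl]; last by rewrite Di ?mulr0.
  have /andP[d0 d1] := D01 (lift ord0 i) l.
  rewrite addr0 normrM [X in _ * X]ger0_norm//.
  by rewrite (le_trans _ (invb j l))// ler_piMr.
apply: opnorm_le => // [|x].
  apply: sumr_ge0 => j _; apply: sumr_ge0 => l _.
  exact: le_trans (normr_ge0 _) (SDe j l).
apply: le_trans (ler_vnorm_mulmx_l1 hp _ _) _.
rewrite ler_wpM2r ?vnorm_ge0//.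
by apply: ler_sum => j _; apply: ler_sum => l _; exact: SDe.
Qed.

Lemma opnorm_le_alpha D i : diag_partition D ->
  opnorm p (invmx (Sv M D) *m D (lift ord0 i)) <= alpha p M i.
Proof. by move=> DD; apply: ub_le_sup; [exact: alpha_has_ubound|exists D]. Qed.

Lemma alpha_ge0 i : 0 <= alpha p M i.
Proof.
pose d (j : 'I_n) (h : 'I_k.+1) : R := (h == ord0)%:R.
have dD : diag_partition (fun i => diag_mx (\row_j d j i)).
  apply: diag_partition_weights => [j h|j]; first by rewrite ler0n.
  by rewrite (bigD1 ord0)//= /d eqxx big1 ?addr0// => h /negbTE ->.
exact: le_trans (opnorm_ge0 hp _) (opnorm_le_alpha _ i dD).
Qed.

(** Apply the inverse of [Sv M D] and bound each operator
    [(Sv M D)^-1 D_i] by [alpha]. *)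
Lemma vnorm_Sv_le D z w : diag_partition D ->
  Sv M D *m z = \sum_i D (lift ord0 i) *m w i ->
  vnorm p z <= \sum_i alpha p M i * vnorm p (w i).
Proof.
move=> DD Sz; have Su : Sv M D \in unitmx.
  by rewrite unitmxE unitfE det_Sv_neq0.
have -> : z = \sum_i (invmx (Sv M D) *m D (lift ord0 i)) *m w i.
  rewrite -[LHS](mulKmx Su) Sz mulmx_sumr.
  by apply: eq_bigr => i _; rewrite mulmxA.
apply: le_trans (ler_vnorm_sum hp _) _; apply: ler_sum => i _.
apply: le_trans (ler_vnorm_mulmx hp _ _) _.
by rewrite ler_wpM2r ?vnorm_ge0// opnorm_le_alpha.
Qed.

(** Read the equation as one for [Sv M D], with [w_i - (A_i - M_i) z] in place
    of [w_i]; the extra terms add up to at most [eta |z|], which is absorbed into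
    the left-hand side as [eta < 1]. *)
Lemma perturb_vnorm_Sv_le eta A D z w : eta < 1 -> perturb_set p eta M A ->
  diag_partition D -> Sv A D *m z = \sum_i D (lift ord0 i) *m w i ->
  vnorm p z <= \sum_i tau p eta M i * vnorm p (w i).
Proof.
move=> eta1 /= hA DD Sz.
have SMz : Sv M D *m z =
    \sum_i D (lift ord0 i) *m (w i - (A i - M i) *m z).
  under eq_bigr do rewrite mulmxBr.
  rewrite sumrB -Sz /Sv !mulmxDl !mulmx_suml -addrA; congr (_ + _).
  rewrite -sumrB; apply: eq_bigr => i _.
  by rewrite !mulmxA mulmxBr mulmxBl subKr.
have zle : vnorm p z <= \sum_i alpha p M i * vnorm p (w i) + eta * vnorm p z.
  apply: le_trans (vnorm_Sv_le _ _ _ DD SMz) _.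
  apply: (@le_trans _ _ (\sum_i (alpha p M i * vnorm p (w i) +
      alpha p M i * opnorm p (A i - M i) * vnorm p z))).
    apply: ler_sum => i _; rewrite -mulrA -mulrDr ler_wpM2l ?alpha_ge0//.
    apply: le_trans (ler_vnormD hp _ _) _; rewrite vnormN// lerD2l.
    exact: ler_vnorm_mulmx.
  by rewrite big_split/= -mulr_suml lerD2l ler_wpM2r ?vnorm_ge0.
rewrite /tau; under eq_bigr do rewrite -mulrA.
rewrite -mulr_sumr mulrC ler_pdivlMr ?subr_gt0//.
by rewrite mulrBr mulr1 lerBlDr [_ * eta]mulrC.
Qed.

Lemma tau_ge0 eta i : eta < 1 -> 0 <= tau p eta M i.
Proof. by move=> e1; rewrite mulr_ge0 ?alpha_ge0// invr_ge0 subr_ge0 ltW. Qed.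

Lemma perturb_row_W eta A : eta < 1 -> perturb_set p eta M A ->
  row_W (block_cons 1%:M A).
Proof.
move=> eta1 hA x /block_min_le0P x_le0 /block_max_ge0P x_ge0.
have [D DD Dx] := diag_partition_comb_eq0 _ x_le0 x_ge0.
have Sx : Sv A D *m x = \sum_i D (lift ord0 i) *m 0.
  rewrite Sv_block mulmx_suml [RHS]big1 => [|i _]; last by rewrite mulmx0.
  by rewrite -[RHS]Dx; apply: eq_bigr => i _; rewrite mulmxA.
apply: (vnorm0_eq0 hp); apply: le_anti; rewrite vnorm_ge0// andbT.
apply: le_trans (perturb_vnorm_Sv_le _ _ _ _ (fun=> 0) eta1 hA DD Sx) _.
by rewrite big1// => i _; rewrite vnorm0// mulr0.
Qed.

End Perturbation.

(** * Differences of solutions *)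

Section Solutions.
Context {R : realType} {n k : nat}.
Implicit Types (A B : 'I_k -> 'M[R]_n) (x y : 'cV[R]_n).
Implicit Types (q r : 'I_k -> 'cV[R]_n).

(** In a row where [x] attains the value [0] at block [i], the difference of
    the two residuals is nonpositive at [i]; where [y] attains it, it is
    nonnegative. *)
Lemma VLCP_sol_diff A B q r x y :
  VLCP_sol (block_cons 1%:M A) (block_cons 0 q) x ->
  VLCP_sol (block_cons 1%:M B) (block_cons 0 r) y ->
  exists2 D, diag_partition D &
    Sv A D *m (x - y) =
    \sum_i D (lift ord0 i) *m ((B i - A i) *m y + (r i - q i)).
Proof.
move=> /block_min_eq0P[x_ge0 x_le0] /block_min_eq0P[y_ge0 y_le0].
pose v i := (block_cons 1%:M A i *m x + block_cons 0 q i)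
            - (block_cons 1%:M B i *m y + block_cons 0 r i).
have vE i j : v i j 0 = (block_cons 1%:M A i *m x + block_cons 0 q i) j 0
    - (block_cons 1%:M B i *m y + block_cons 0 r i) j 0.
  by rewrite [LHS]mxE [X in _ + X]mxE.
have [|//|D DD Dv] := diag_partition_comb_eq0 v.
- move=> j; have [i xi] := x_le0 j; exists i.
  by rewrite vE subr_le0 (le_trans xi).
- move=> j; have [i yi] := y_le0 j; exists i.
  by rewrite vE subr_ge0 (le_trans yi).
exists D => //; apply/eqP; rewrite -subr_eq0 -[X in _ == X]Dv; apply/eqP.
rewrite big_ord_recl /v !block_cons0 !mul1mx !addr0 /Sv mulmxDl -addrA.
congr (_ + _); rewrite mulmx_suml -sumrB; apply: eq_bigr => i _.
rewrite !block_consS -mulmxA -mulmxBr; congr (_ *m _).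
rewrite mulmxBr mulmxBl; apply/matrixP => j l; rewrite !mxE; ring.
Qed.

(** The reference solution with which other solutions are compared to bound
    their norm. *)
Lemma VLCP_sol0 B r : (forall i, lev 0 (r i)) ->
  VLCP_sol (block_cons 1%:M B) (block_cons 0 r) 0.
Proof.
move=> r0; apply/block_min_eq0P; split=> [i j|j].
  rewrite mulmx0 add0r; case: (unliftP ord0 i) => [i'|] ->.
    by rewrite block_consS; have := r0 i' j; rewrite mxE.
  by rewrite block_cons0 mxE.
by exists ord0; rewrite mulmx0 add0r block_cons0 mxE.
Qed.

End Solutions.

(** * Perturbation bounds for solutions *)

Theorem theorem3p3 (R : realType) (n k : nat) (p : \bar R) (hp : (1 <= p)%E)
    (M : 'I_k -> 'M[R]_n) (hM : row_W (block_cons 1%:M M)) :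
  (forall (q q' : 'I_k -> 'cV[R]_n) (x y : 'cV[R]_n),
      VLCP_sol (block_cons 1%:M M) (block_cons 0 q) x ->
      VLCP_sol (block_cons 1%:M M) (block_cons 0 q') y ->
      vnorm p (x - y) <= \sum_(i < k) alpha p M i * vnorm p (q' i - q i))
  /\
  (forall eta : R, 0 <= eta -> eta < 1 ->
      (forall A : 'I_k -> 'M[R]_n,
          perturb_set p eta M A -> row_W (block_cons 1%:M A))
      /\
      (forall (A B : 'I_k -> 'M[R]_n) (q r : 'I_k -> 'cV[R]_n)
              (x y : 'cV[R]_n),
          perturb_set p eta M A -> perturb_set p eta M B ->
          VLCP_sol (block_cons 1%:M A) (block_cons 0 q) x ->
          VLCP_sol (block_cons 1%:M B) (block_cons 0 r) y ->
          vnorm p (x - y) <=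
            (\sum_(i < k) tau p eta M i * opnorm p (A i - B i)) *
            (\sum_(i < k) tau p eta M i * vnorm p (pos_part (- r i)))
            + \sum_(i < k) tau p eta M i * vnorm p (q i - r i))).
Proof.
split=> [q q' x y solx soly|eta eta0 eta1].
  have [D DD Sxy] := VLCP_sol_diff _ _ _ _ _ _ solx soly.
  apply: (vnorm_Sv_le hp hM _ _ _ DD); rewrite Sxy.
  by apply: eq_bigr => i _; rewrite subrr mul0mx add0r.
split=> [A hA|A B q r x y hA hB solx soly].
  exact: (perturb_row_W hp hM _ _ eta1 hA).
have y_le : vnorm p y <= \sum_i tau p eta M i * vnorm p (pos_part (- r i)).
  (* [r + (-r)_+ = r_+] is nonnegative, and it differs from [r] by [(-r)_+]. *)
  have sol0 : VLCP_sol (block_cons 1%:M B)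
      (block_cons 0 (fun i => r i + pos_part (- r i))) 0.
    by apply: VLCP_sol0 => i j; rewrite !mxE; case: (leP 0 (- r i j 0)); lra.
  have [D DD Sy] := VLCP_sol_diff _ _ _ _ _ _ soly sol0.
  rewrite subr0 in Sy.
  apply: (perturb_vnorm_Sv_le hp hM _ _ _ _ _ eta1 hB DD); rewrite Sy.
  by apply: eq_bigr => i _; rewrite mulmx0 add0r addrAC subrr add0r.
have [D DD Sxy] := VLCP_sol_diff _ _ _ _ _ _ solx soly.
apply: le_trans (perturb_vnorm_Sv_le hp hM _ _ _ _ _ eta1 hA DD Sxy) _.
apply: (@le_trans _ _ (\sum_(i < k) (tau p eta M i * opnorm p (A i - B i) *
    vnorm p y + tau p eta M i * vnorm p (q i - r i)))).
  apply: ler_sum => i _; rewrite -mulrA -mulrDr ler_wpM2l ?tau_ge0//.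
  rewrite -opprB mulNmx -[X in _ + X]opprB -opprD vnormN//.
  apply: le_trans (ler_vnormD hp _ _) _; rewrite lerD2r.
  exact: ler_vnorm_mulmx.
rewrite big_split/= -mulr_suml lerD2r ler_wpM2l//.
by apply: sumr_ge0 => i _; rewrite mulr_ge0 ?tau_ge0 ?opnorm_ge0.
Qed.
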